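(* Let $k$ be a field and let $\mathfrak{h}$ be a Leibniz algebra over $k$ of dimension $n$. Then, for any commutative bialgebra $B$ over $k$ and any Leibniz algebra homomorphism $f:\mathfrak{h}\to\mathfrak{h}\otimes B$ which makes $\mathfrak{h}$ into a right $B$-comodule, there exists a unique bialgebra homomorphism $\theta:\mathcal{A}(\mathfrak{h})\to B$ such that $$(\mathrm{Id}_{\mathfrak{h}}\otimes\theta)\circ\eta_{\mathfrak{h}}=f.$$
   Context: All vector spaces, algebras and tensor products are over an arbitrary field $k$; algebras are unital and algebra homomorphisms preserve units. A Leibniz algebra is a vector space $\mathfrak{h}$ with a bilinear map $[-,-]$ satisfying $[x,[y,z]] = [[x,y],z]-[[x,z],y]$ for all $x,y,z$; homomorphisms are bracket-preserving linear maps. For a Leibniz algebra $\mathfrak{h}$ and a commutative algebra $A$, $\mathfrak{h}\otimes A$ is the Leibniz algebra with bracket $[x\otimes a,y\otimes b]:=[x,y]\otimes ab$. Universal coacting bialgebra $(\mathcal{A}(\mathfrak{h}),\eta_{\mathfrak{h}})$: fix a basis $\{e_1,\dots,e_n\}$ of the $n$-dimensional Leibniz algebra $\mathfrak{h}$, with structure constants $[e_i,e_j]=\sum_{s=1}^n\tau_{i,j}^s e_s$. Then $\mathcal{A}(\mathfrak{h}):=k[X_{ij}\mid i,j=1,\dots,n]/J$, where $J$ is the ideal generated by the polynomials $$\sum_{u=1}^n\tau_{i,j}^u X_{au}-\sum_{s,t=1}^n\tau_{s,t}^a X_{si}X_{tj},\qquad a,i,j=1,\dots,n.$$ Write $x_{ij}$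 for the class of $X_{ij}$. $\mathcal{A}(\mathfrak{h})$ is a commutative bialgebra with $\Delta(x_{ij})=\sum_{s=1}^n x_{is}\otimes x_{sj}$ and $\varepsilon(x_{ij})=\delta_{i,j}$. The map $\eta_{\mathfrak{h}}:\mathfrak{h}\to\mathfrak{h}\otimes\mathcal{A}(\mathfrak{h})$ is the linear map given by $\eta_{\mathfrak{h}}(e_i):=\sum_{s=1}^n e_s\otimes x_{si}$; it is a Leibniz algebra homomorphism and a right $\mathcal{A}(\mathfrak{h})$-comodule structure on $\mathfrak{h}$. *)

(* Defs.v *)
From HB Require Import structures.
From mathcomp Require Import all_boot all_algebra.
From mathcomp Require Import boolp classical_sets.
From mathcomp Require Import mpoly.

Set Implicit Arguments.
Unset Strict Implicit.
Unset Printing Implicit Defensive.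

Import GRing.Theory.

Local Open Scope ring_scope.
Local Open Scope quotient_scope.

Section TensorDef.
Variables (k : fieldType) (U V : lmodType k).

(* A list [(u1, v1); ...; (um, vm)] stands for u1 (x) v1 + ... + um (x) vm. *)
Inductive tensor_rel : seq (U * V) -> seq (U * V) -> Prop :=
| TensorRefl s : tensor_rel s s
| TensorSym s t : tensor_rel s t -> tensor_rel t s
| TensorTrans s t r : tensor_rel s t -> tensor_rel t r -> tensor_rel s r
| TensorCat s s' t t' :
    tensor_rel s s' -> tensor_rel t t' -> tensor_rel (s ++ t) (s' ++ t')
| TensorComm s t : tensor_rel (s ++ t) (t ++ s)
| TensorZero v : tensor_rel [:: (0, v)] [::]
| TensorDl u u' v : tensor_rel [:: (u + u', v)] [:: (u, v); (u', v)]
| TensorDr u v v' : tensor_rel [:: (u, v + v')] [:: (u, v); (u, v')]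
| TensorZ a u v : tensor_rel [:: (a *: u, v)] [:: (u, a *: v)].

Definition tensor_equiv (s t : seq (U * V)) : bool := `[< tensor_rel s t >].

Lemma tensor_equivP : equiv_class_of tensor_equiv.
Proof.
split=> [s|s t|t s r].
- exact/asboolP/TensorRefl.
- by apply/asboolP/asboolP => /TensorSym.
- by move=> /asboolP st /asboolP tr; apply/asboolP/(TensorTrans st tr).
Qed.

Canonical tensor_equiv_equiv := EquivRelPack tensor_equivP.
Canonical tensor_equiv_encModRel := defaultEncModRel tensor_equiv.

Definition tensor := {eq_quot tensor_equiv}.

HB.instance Definition _ := EqQuotient.on tensor.
HB.instance Definition _ := Choice.on tensor.

Definition cltens (s : seq (U * V)) : tensor := \pi_tensor s.

Lemma cltensP s t : tensor_rel s t <-> cltens s = cltens t.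
Proof.
split=> [st|/eqquotP/asboolP //].
by apply/eqquotP/asboolP.
Qed.

Lemma cltens_repr t : cltens (repr t) = t. Proof. exact: reprK. Qed.

Definition tensor_zero : tensor := cltens [::].
Definition tensor_add (x y : tensor) : tensor := cltens (repr x ++ repr y).
Definition tensor_scale (a : k) (x : tensor) : tensor :=
  cltens [seq (a *: p.1, p.2) | p <- repr x].
Definition tensor_opp (x : tensor) : tensor := tensor_scale (-1) x.

Lemma tensor_addE s t : tensor_add (cltens s) (cltens t) = cltens (s ++ t).
Proof.
by apply/cltensP/TensorCat; apply/cltensP; rewrite cltens_repr.
Qed.

Lemma tensor_rel_scale a s t : tensor_rel s t ->
  tensor_rel [seq (a *: p.1, p.2) | p <- s] [seq (a *: p.1, p.2) | p <- t].
Proof.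
elim=> {s t} [s|s t _|s t r _ st _|s s' t t' _ h _ h'|s t|v|u u' v|u v v'|b u v].
- exact: TensorRefl.
- exact: TensorSym.
- exact: TensorTrans.
- by rewrite !map_cat; exact: TensorCat.
- by rewrite !map_cat; exact: TensorComm.
- by rewrite /= scaler0; exact: TensorZero.
- by rewrite /= scalerDr; exact: TensorDl.
- exact: TensorDr.
- by rewrite /= scalerA mulrC -scalerA; exact: TensorZ.
Qed.

Lemma tensor_scaleE a s :
  tensor_scale a (cltens s) = cltens [seq (a *: p.1, p.2) | p <- s].
Proof.
by apply/cltensP/tensor_rel_scale/cltensP; rewrite cltens_repr.
Qed.

Lemma tensor_addA : associative tensor_add.
Proof.
move=> x y z; rewrite -[x]cltens_repr -[y]cltens_repr -[z]cltens_repr.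
by rewrite !tensor_addE catA.
Qed.

Lemma tensor_addC : commutative tensor_add.
Proof. by move=> x y; apply/cltensP/TensorComm. Qed.

Lemma tensor_add0 : left_id tensor_zero tensor_add.
Proof. by move=> x; rewrite -[x]cltens_repr tensor_addE. Qed.

Lemma tensor_scaleDl x a b :
  tensor_scale (a + b) x = tensor_add (tensor_scale a x) (tensor_scale b x).
Proof.
rewrite -[x]cltens_repr !tensor_scaleE tensor_addE; apply/cltensP.
elim: (repr x) => [|[u v] s IHs] /=; first exact: TensorRefl.
rewrite scalerDl.
have /= h := TensorCat (TensorDl (a *: u) (b *: u) v) IHs.
apply: TensorTrans h _.
set A := map _ s; set B := map _ s.
have h : tensor_rel (([:: (b *: u, v)] ++ A) ++ B) ((A ++ [:: (b *: u, v)]) ++ B).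
  by apply: TensorCat; [exact: TensorComm|exact: TensorRefl].
by have := TensorCat (TensorRefl [:: (a *: u, v)]) h; rewrite /= -catA.
Qed.

Lemma tensor_scale0 x : tensor_scale 0 x = tensor_zero.
Proof.
rewrite -[x]cltens_repr tensor_scaleE; apply/cltensP.
elim: (repr x) => [|[u v] s IHs] /=; first exact: TensorRefl.
by rewrite scale0r -cat1s -[[::]]/([::] ++ [::]); apply: TensorCat => //;
  exact: TensorZero.
Qed.

Lemma tensor_scale1 : left_id 1 tensor_scale.
Proof.
move=> x; rewrite -[x]cltens_repr tensor_scaleE; congr cltens.
by rewrite -[RHS]map_id; apply: eq_map => -[u v] /=; rewrite scale1r.
Qed.

Lemma tensor_addN : left_inverse tensor_zero tensor_opp tensor_add.
Proof.
move=> x; rewrite -{2}[x]tensor_scale1 -tensor_scaleDl addNr.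
exact: tensor_scale0.
Qed.

HB.instance Definition _ :=
  GRing.isZmodule.Build tensor tensor_addA tensor_addC tensor_add0 tensor_addN.

Lemma tensor_scaleA a b x :
  tensor_scale a (tensor_scale b x) = tensor_scale (a * b) x.
Proof.
rewrite -[x]cltens_repr !tensor_scaleE -map_comp; congr cltens.
by apply: eq_map => p /=; rewrite scalerA.
Qed.

Lemma tensor_scaleDr : right_distributive tensor_scale +%R.
Proof.
move=> a x y; rewrite -[x]cltens_repr -[y]cltens_repr.
rewrite -[_ + _ in LHS]/(tensor_add _ _) tensor_addE !tensor_scaleE map_cat.
by rewrite -tensor_addE.
Qed.

HB.instance Definition _ := GRing.Zmodule_isLmodule.Build k tensor
  tensor_scaleA tensor_scale1 tensor_scaleDr tensor_scaleDl.

Definition tens (u : U) (v : V) : tensor := cltens [:: (u, v)].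

End TensorDef.

Notation "U ⊗ V" := (tensor U%type V%type) (at level 40, left associativity) : type_scope.
Notation "u ⊗ v" := (tens u v) (at level 40, left associativity) : ring_scope.

Definition bilin (k : fieldType) (U V W : lmodType k) (f : U -> V -> W) : Prop :=
  (forall v, linear (f^~ v)) /\ (forall u, linear (f u)).

Lemma lin0 (k : fieldType) (U V : lmodType k) (f : U -> V) :
  linear f -> f 0 = 0.
Proof.
by move=> fl; apply: (addIr (f 0)); have := fl 1 0 0; rewrite !scale1r addr0 add0r.
Qed.

Section BilinTheory.
Variables (k : fieldType) (U V W : lmodType k) (f : U -> V -> W).
Hypothesis fb : bilin f.

Lemma bilinDl u u' v : f (u + u') v = f u v + f u' v.
Proof. by have := fb.1 v 1 u u'; rewrite !scale1r. Qed.
Lemma bilinDr u v v' : f u (v + v') = f u v + f u v'.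
Proof. by have := fb.2 u 1 v v'; rewrite !scale1r. Qed.
Lemma bilin0l v : f 0 v = 0.
Proof. by apply: (addrI (f 0 v)); rewrite -bilinDl !addr0. Qed.
Lemma bilin0r u : f u 0 = 0.
Proof. by apply: (addrI (f u 0)); rewrite -bilinDr !addr0. Qed.
Lemma bilinZl a u v : f (a *: u) v = a *: f u v.
Proof. by have := fb.1 v a u 0; rewrite bilin0l !addr0. Qed.
Lemma bilinZr a u v : f u (a *: v) = a *: f u v.
Proof. by have := fb.2 u a v 0; rewrite bilin0r !addr0. Qed.

End BilinTheory.

Section TensorTheory.
Variables (k : fieldType) (U V : lmodType k).
Implicit Types (x y : U ⊗ V).

Lemma cltens_sum (s : seq (U * V)) : cltens s = \sum_(p <- s) (p.1 ⊗ p.2).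
Proof.
elim: s => [|[u v] s IHs]; first by rewrite big_nil.
by rewrite big_cons -IHs -[RHS]/(tensor_add _ _) tensor_addE.
Qed.

Lemma tensor_ind (P : U ⊗ V -> Prop) :
  P 0 -> (forall u v x, P x -> P (u ⊗ v + x)) -> forall x, P x.
Proof.
move=> P0 PD x; rewrite -[x]cltens_repr cltens_sum.
elim: (repr x) => [|p s IHs]; first by rewrite big_nil.
by rewrite big_cons; apply: PD.
Qed.

Lemma tens_bilin : bilin (@tens k U V).
Proof.
split=> [v a u u'|u a v v'].
  rewrite -[RHS]/(tensor_add (tensor_scale _ _) _) tensor_scaleE tensor_addE.
  exact/cltensP/TensorDl.
rewrite -[RHS]/(tensor_add (tensor_scale _ _) _) tensor_scaleE tensor_addE.
apply/cltensP/(TensorTrans (TensorDr _ _ _)).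
rewrite -[X in tensor_rel X]cat1s; apply: TensorCat; last exact: TensorRefl.
exact/TensorSym/TensorZ.
Qed.

Lemma tensDl u u' (v : V) : (u + u' : U) ⊗ v = u ⊗ v + u' ⊗ v.
Proof. by have := tens_bilin.1 v 1 u u'; rewrite !scale1r. Qed.
Lemma tensDr (u : U) (v v' : V) : u ⊗ (v + v') = u ⊗ v + u ⊗ v'.
Proof. by have := tens_bilin.2 u 1 v v'; rewrite !scale1r. Qed.
Lemma tens0l (v : V) : (0 : U) ⊗ v = 0.
Proof. by apply: (addrI (0 ⊗ v)); rewrite -tensDl !addr0. Qed.
Lemma tens0r (u : U) : u ⊗ (0 : V) = 0.
Proof. by apply: (addrI (u ⊗ 0)); rewrite -tensDr !addr0. Qed.
Lemma tensZl a (u : U) (v : V) : (a *: u) ⊗ v = a *: (u ⊗ v).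
Proof. by have := tens_bilin.1 v a u 0; rewrite tens0l !addr0. Qed.
Lemma tensZr a (u : U) (v : V) : u ⊗ (a *: v) = a *: (u ⊗ v).
Proof. by have := tens_bilin.2 u a v 0; rewrite tens0r !addr0. Qed.
Lemma tens_suml I (r : seq I) (P : pred I) (F : I -> U) (v : V) :
  (\sum_(i <- r | P i) F i) ⊗ v = \sum_(i <- r | P i) (F i ⊗ v).
Proof. by apply: (big_morph (fun u => u ⊗ v)) => [u u'|]; rewrite ?tensDl ?tens0l. Qed.
Lemma tens_sumr I (r : seq I) (P : pred I) (u : U) (F : I -> V) :
  u ⊗ (\sum_(i <- r | P i) F i) = \sum_(i <- r | P i) (u ⊗ F i).
Proof. by apply: (big_morph (tens u)) => [v v'|]; rewrite ?tensDr ?tens0r. Qed.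

Section Lift.
Variables (W : lmodType k) (f : U -> V -> W).

(* The linear map induced by f; meaningful only when f is bilinear, as it is
   computed on an arbitrary representative. *)
Definition tlift (x : U ⊗ V) : W := \sum_(p <- repr x) f p.1 p.2.

Hypothesis f_bilin : bilin f.

Lemma tlift_cltens s : tlift (cltens s) = \sum_(p <- s) f p.1 p.2.
Proof.
have h s1 s2 : tensor_rel s1 s2 ->
    \sum_(p <- s1) f p.1 p.2 = \sum_(p <- s2) f p.1 p.2; last first.
  by apply/h/cltensP; rewrite cltens_repr.
elim=> {s s1 s2} [//|s t _ ->//|s t r _ -> _ ->//|s s' t t' _ h _ h'|s t|v|u u' v|
  u v v'|b u v]; rewrite ?big_cat ?big_cons ?big_nil ?addr0 /=.
- by rewrite h h'.
- by rewrite addrC.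
- by rewrite (bilin0l f_bilin).
- by rewrite (bilinDl f_bilin).
- by rewrite (bilinDr f_bilin).
- by rewrite (bilinZl f_bilin) (bilinZr f_bilin).
Qed.

Lemma tlift_tens u v : tlift (u ⊗ v) = f u v.
Proof. by rewrite tlift_cltens big_seq1. Qed.

Lemma tlift_linear : linear tlift.
Proof.
move=> a x y; rewrite -[x]cltens_repr -[y]cltens_repr.
rewrite -[X in tlift X]/(tensor_add (tensor_scale _ _) _).
rewrite tensor_scaleE tensor_addE !tlift_cltens big_cat /= big_map scaler_sumr.
by congr (_ + _); apply: eq_bigr => p _; rewrite (bilinZl f_bilin).
Qed.

End Lift.

Lemma tensor_ext (W : lmodType k) (f g : U ⊗ V -> W) :
  linear f -> linear g -> (forall u v, f (u ⊗ v) = g (u ⊗ v)) -> f =1 g.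
Proof.
move=> fl gl fg; elim/tensor_ind => [|u v x IHx].
  by rewrite !lin0.
by rewrite -[u ⊗ v]scale1r fl gl fg IHx.
Qed.

End TensorTheory.

Section TensorMaps.
Variable k : fieldType.

(* The map f (x) g; meaningful only when f and g are linear. *)
Definition tmap (U V U' V' : lmodType k) (f : U -> U') (g : V -> V') :
    U ⊗ V -> U' ⊗ V' :=
  tlift (fun u v => f u ⊗ g v).

Definition tassoc (U V W : lmodType k) : (U ⊗ V) ⊗ W -> U ⊗ (V ⊗ W) :=
  tlift (fun x w => tlift (fun u v => u ⊗ (v ⊗ w)) x).

Lemma tmap_bilin (U V U' V' : lmodType k) (f : U -> U') (g : V -> V') :
  linear f -> linear g -> bilin (fun u v => f u ⊗ g v).
Proof.
move=> fl gl; split=> [v a u u'|u a v v'] /=.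
  by rewrite fl tensDl tensZl.
by rewrite gl tensDr tensZr.
Qed.

Lemma tmap_tens (U V U' V' : lmodType k) (f : U -> U') (g : V -> V') u v :
  linear f -> linear g -> tmap f g (u ⊗ v) = f u ⊗ g v.
Proof. by move=> fl gl; rewrite /tmap tlift_tens //; exact: tmap_bilin. Qed.

Lemma tmap_linear (U V U' V' : lmodType k) (f : U -> U') (g : V -> V') :
  linear f -> linear g -> linear (tmap f g).
Proof. by move=> fl gl; apply: tlift_linear; exact: tmap_bilin. Qed.

Lemma tassoc_bilin_in (U V W : lmodType k) (w : W) :
  bilin (fun (u : U) (v : V) => u ⊗ (v ⊗ w)).
Proof.
split=> [v a u u'|u a v v'] /=; first by rewrite tensDl tensZl.
by rewrite tensDl tensZl tensDr tensZr.
Qed.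

Lemma tassoc_bilin (U V W : lmodType k) :
  bilin (fun (x : U ⊗ V) (w : W) => tlift (fun u v => u ⊗ (v ⊗ w)) x).
Proof.
split=> [w|x a w w']; first exact/tlift_linear/tassoc_bilin_in.
have lin w0 := tlift_linear (@tassoc_bilin_in U V W w0).
have tl w0 := tlift_tens (@tassoc_bilin_in U V W w0).
elim/tensor_ind: x => [|u v x IHx].
  by rewrite !(lin0 (lin _)) scaler0 addr0.
rewrite -[u ⊗ v]scale1r !lin !tl IHx !scale1r !tensDr !tensZr scalerDr.
by rewrite addrACA.
Qed.

Lemma tassoc_tens (U V W : lmodType k) (u : U) (v : V) (w : W) :
  tassoc ((u ⊗ v) ⊗ w) = u ⊗ (v ⊗ w).
Proof.
rewrite /tassoc tlift_tens; last exact: tassoc_bilin.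
by rewrite tlift_tens //; exact: tassoc_bilin_in.
Qed.

Lemma tassoc_linear (U V W : lmodType k) : linear (@tassoc U V W).
Proof. exact/tlift_linear/tassoc_bilin. Qed.

Section Map2.
Variables (U1 V1 U2 V2 U V : lmodType k).
Variables (f : U1 -> U2 -> U) (g : V1 -> V2 -> V).

(* The bilinear map (u1 (x) v1, u2 (x) v2) |-> f u1 u2 (x) g v1 v2, for f and g
   bilinear. *)
Definition tmap2 (x : U1 ⊗ V1) (y : U2 ⊗ V2) : U ⊗ V :=
  tlift (fun u v => tmap (f u) (g v) y) x.

Hypotheses (fb : bilin f) (gb : bilin g).

Lemma tmap2_bilin_in y : bilin (fun u v => tmap (f u) (g v) y).
Proof.
have ml u v : linear (tmap (f u) (g v)).
  by apply: tmap_linear; [exact: fb.2|exact: gb.2].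
have mt u v u' v' : tmap (f u) (g v) (u' ⊗ v') = f u u' ⊗ g v v'.
  by rewrite tmap_tens //; [exact: fb.2|exact: gb.2].
have m0 u v : tmap (f u) (g v) 0 = 0 by exact: lin0 (ml u v).
split=> [v a u u'|u a v v']; elim/tensor_ind: y => [|p q y IHy].
- by rewrite !m0 scaler0 addr0.
- rewrite -[p ⊗ q]scale1r !ml !mt IHy !scale1r fb.1 tensDl tensZl scalerDr.
  by rewrite addrACA.
- by rewrite !m0 scaler0 addr0.
- rewrite -[p ⊗ q]scale1r !ml !mt IHy !scale1r gb.1 tensDr tensZr scalerDr.
  by rewrite addrACA.
Qed.

Lemma tmap2_tens u1 v1 u2 v2 :
  tmap2 (u1 ⊗ v1) (u2 ⊗ v2) = f u1 u2 ⊗ g v1 v2.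
Proof.
rewrite /tmap2 tlift_tens; last exact: tmap2_bilin_in.
by rewrite tmap_tens //; [exact: fb.2|exact: gb.2].
Qed.

Lemma tmap2_bilin : bilin tmap2.
Proof.
split=> [y|x a y y']; first exact/tlift_linear/tmap2_bilin_in.
rewrite /tmap2 /tlift scaler_sumr -big_split; apply: eq_bigr => p _.
by rewrite tmap_linear //; [exact: fb.2|exact: gb.2].
Qed.

End Map2.

End TensorMaps.

(* Used to see that A (x) B is not the zero ring, as the algebra structures of
   the library are nontrivial by definition. *)
Lemma ex_functional (k : fieldType) (V : lmodType k) (v : V) : v != 0 ->
  exists l : V -> k^o, linear l /\ l v = 1.
Proof.
move=> v0.
pose P (A : set V) := ~ A v /\
  forall a x y, A x -> A y -> A (a *: x + y).
have [|A [[Av Alin] Amax]] := @Zorn_bigcup V P.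
  move=> F FP Ftot; split=> [[A FA Av]|a x y [A FA Ax] [B FB By]].
    exact: (FP A FA).1.
  have [AB|BA] := Ftot A B FA FB.
    by exists B => //; apply: (FP B FB).2 => //; exact: AB.
  by exists A => //; apply: (FP A FA).2 => //; exact: BA.
have A0 : A 0.
  apply: contrapT => nA0; apply: (Amax [set 0]%classic).
    split=> [x Ax|/(_ 0 erefl) //].
    by case: nA0; have := Alin (-1) x x Ax Ax; rewrite scaleN1r addNr.
  split=> [/= e|a x y /= -> ->]; first by rewrite e eqxx in v0.
  by rewrite scaler0 addr0.
have Az a x : A x -> A (a *: x) by move=> Ax; rewrite -[_ *: _]addr0; exact: Alin.
have AD x y : A x -> A y -> A (x + y).
  by move=> Ax Ay; rewrite -[x]scale1r; exact: Alin.
have ex x : exists c : k, A (x - c *: v).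
  apply: contrapT => nx.
  have nAx : ~ A x by move=> Ax; apply: nx; exists 0; rewrite scale0r subr0.
  apply: (Amax (fun y => exists c : k, A (y - c *: x))).
    split=> [y Ay|sub]; first by exists 0; rewrite scale0r subr0.
    by apply/nAx/sub; exists 1; rewrite scale1r subrr.
  split=> [[c Ac]|a y z [c Ac] [d Ad]].
    have [c0|c0] := eqVneq c 0.
      by apply: Av; move: Ac; rewrite c0 scale0r subr0.
    apply: nx; exists c^-1; have := Az (- c^-1) _ Ac.
    by rewrite scalerBr scalerA mulNr mulVf // !scaleNr scale1r opprK addrC.
  exists (a * c + d); have := Alin a _ _ Ac Ad.
  by rewrite scalerBr scalerA scalerDl opprD addrACA.
have uniq x c d : A (x - c *: v) -> A (x - d *: v) -> c = d.
  move=> Ac Ad; apply: contrapT => /eqP cd; apply: Av.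
  have := Alin (-1) _ _ Ac Ad; rewrite scaleN1r opprB addrA subrK -scalerBl.
  by move/(Az (c - d)^-1); rewrite scalerA mulVf ?scale1r // subr_eq0.
have [l lP] := choice ex.
exists l; split.
  move=> a x y; apply: (uniq (a *: x + y)) => //.
  have := Alin a _ _ (lP x) (lP y).
  by rewrite scalerBr scalerA scalerDl opprD addrACA.
by apply: (uniq v) => //; rewrite scale1r subrr.
Qed.

Section TensorAlgebra.
Variables (k : fieldType) (A B : comAlgType k).

Definition tensor_one : A ⊗ B := 1 ⊗ 1.
Definition tensor_mul (x y : A ⊗ B) : A ⊗ B := tmap2 *%R *%R x y.

Lemma mul_bilin (C : comAlgType k) : bilin (@GRing.mul C).
Proof.
split=> [y a x x'|x a y y'] /=; first by rewrite mulrDl scalerAl.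
by rewrite mulrDr scalerAr.
Qed.

Let mulb : bilin tensor_mul.
Proof. by apply: tmap2_bilin; exact: mul_bilin. Qed.

Lemma tensor_mul_tens a b a' b' :
  tensor_mul (a ⊗ b) (a' ⊗ b') = (a * a') ⊗ (b * b').
Proof. by apply: tmap2_tens; exact: mul_bilin. Qed.

Lemma tensor_mulC : commutative tensor_mul.
Proof.
move=> x y; elim/tensor_ind: x => [|a b x IHx].
  by rewrite (bilin0l mulb) (bilin0r mulb).
rewrite (bilinDl mulb) (bilinDr mulb) IHx; congr (_ + _).
elim/tensor_ind: y {IHx} => [|a' b' y IHy].
  by rewrite (bilin0l mulb) (bilin0r mulb).
rewrite (bilinDl mulb) (bilinDr mulb) IHy !tensor_mul_tens.
by rewrite (mulrC a) (mulrC b).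
Qed.

Lemma tensor_mulA : associative tensor_mul.
Proof.
move=> x y z; elim/tensor_ind: x => [|a b x IHx].
  by rewrite !(bilin0l mulb).
rewrite !(bilinDl mulb) IHx; congr (_ + _) => {x IHx}.
elim/tensor_ind: y => [|a' b' y IHy].
  by rewrite !((bilin0l mulb), (bilin0r mulb)).
rewrite !((bilinDl mulb), (bilinDr mulb)) IHy; congr (_ + _) => {y IHy}.
elim/tensor_ind: z => [|a'' b'' z IHz].
  by rewrite !(bilin0r mulb).
by rewrite !(bilinDr mulb) IHz !tensor_mul_tens !mulrA.
Qed.

Lemma tensor_mul1 : left_id tensor_one tensor_mul.
Proof.
elim/tensor_ind => [|a b x IHx]; first by rewrite (bilin0r mulb).
by rewrite (bilinDr mulb) IHx tensor_mul_tens !mul1r.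
Qed.

Lemma tensor_mulDl : left_distributive tensor_mul +%R.
Proof. by move=> x y z; exact: bilinDl. Qed.

Lemma tensor_one_neq0 : tensor_one != 0.
Proof.
have [l [ll l1]] := ex_functional (oner_neq0 A).
have [m [ml m1]] := ex_functional (oner_neq0 B).
have lmb : bilin (fun a b => (l a * m b : k^o)).
  split=> [b a x y|x a b y] /=.
    by rewrite ll mulrDl -scalerAl.
  by rewrite ml mulrDr -scalerAr.
have lin := tlift_linear lmb.
apply/eqP => e; have := tlift_tens lmb 1 1; rewrite l1 m1 mulr1.
rewrite -[_ ⊗ _]/tensor_one e.
rewrite (lin0 lin).
by move/eqP; rewrite eq_sym oner_eq0.
Qed.

HB.instance Definition _ := GRing.Zmodule_isComNzRing.Build (tensor A B)
  tensor_mulA tensor_mulC tensor_mul1 tensor_mulDl tensor_one_neq0.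

Lemma tensor_scaleAl a (x y : A ⊗ B) : a *: (x * y) = (a *: x) * y.
Proof. by rewrite -[RHS]/(tensor_mul _ _) (bilinZl mulb). Qed.

HB.instance Definition _ :=
  GRing.Lmodule_isLalgebra.Build k (tensor A B) tensor_scaleAl.
HB.instance Definition _ := GRing.Lalgebra_isComAlgebra.Build k (tensor A B).

Lemma tens_mul (a a' : A) (b b' : B) :
  (a ⊗ b) * (a' ⊗ b') = (a * a') ⊗ (b * b').
Proof. exact: tensor_mul_tens. Qed.

Lemma tens_one : (1 : A) ⊗ (1 : B) = 1. Proof. by []. Qed.

End TensorAlgebra.

Section TensorAlgebraMaps.
Variable k : fieldType.

Lemma tmap_monoid (A B A' B' : comAlgType k) (f : A -> A') (g : B -> B') :
  linear f -> monoid_morphism f -> linear g -> monoid_morphism g ->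
  monoid_morphism (tmap f g).
Proof.
move=> fl [f1 fM] gl [g1 gM].
have tl := tmap_linear fl gl; have tt u v := tmap_tens u v fl gl.
split=> [|x y]; first by rewrite -tens_one tt f1 g1.
elim/tensor_ind: x => [|a b x IHx]; first by rewrite !mul0r !(lin0 tl) mul0r.
rewrite mulrDl -[_ * _ in LHS]scale1r tl scale1r IHx.
rewrite -[a ⊗ b in RHS]scale1r tl scale1r mulrDl; congr (_ + _) => {x IHx}.
elim/tensor_ind: y => [|a' b' y IHy]; first by rewrite !mulr0 !(lin0 tl) mulr0.
rewrite mulrDr -[_ * _ in LHS]scale1r tl scale1r IHy.
rewrite -[a' ⊗ b' in RHS]scale1r tl scale1r mulrDr; congr (_ + _) => {y IHy}.
by rewrite tens_mul !tt fM gM tens_mul.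
Qed.

Lemma tassoc_monoid (A B C : comAlgType k) : monoid_morphism (@tassoc k A B C).
Proof.
have tl := @tassoc_linear k A B C; have tt := @tassoc_tens k A B C.
split=> [|x y]; first by rewrite -[LHS]/(tassoc ((1 ⊗ 1) ⊗ 1)) tt.
elim/tensor_ind: x => [|t c x IHx]; first by rewrite !mul0r !(lin0 tl) mul0r.
rewrite mulrDl -[_ * _ in LHS]scale1r tl scale1r IHx.
rewrite -[t ⊗ c in RHS]scale1r tl scale1r mulrDl; congr (_ + _) => {x IHx}.
elim/tensor_ind: y => [|t' c' y IHy]; first by rewrite !mulr0 !(lin0 tl) mulr0.
rewrite mulrDr -[_ * _ in LHS]scale1r tl scale1r IHy.
rewrite -[t' ⊗ c' in RHS]scale1r tl scale1r mulrDr; congr (_ + _) => {y IHy}.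
elim/tensor_ind: t => [|a b t IHt].
  by rewrite !tens0l !mul0r !(lin0 tl) mul0r.
rewrite tensDl mulrDl -[_ * _ in LHS]scale1r tl scale1r IHt.
rewrite -[(a ⊗ b) ⊗ c in RHS]scale1r tl scale1r mulrDl; congr (_ + _) => {t IHt}.
elim/tensor_ind: t' => [|a' b' t IHt].
  by rewrite !tens0l !mulr0 !(lin0 tl) mulr0.
rewrite tensDl mulrDr -[_ * _ in LHS]scale1r tl scale1r IHt.
rewrite -[(a' ⊗ b') ⊗ c' in RHS]scale1r tl scale1r mulrDr; congr (_ + _).
by rewrite !(tens_mul, tt).
Qed.

Lemma linear_comp (U V W : lmodType k) (f : V -> W) (g : U -> V) :
  linear f -> linear g -> linear (f \o g).
Proof. by move=> fl gl a x y; rewrite /= gl fl. Qed.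

Lemma monoid_comp (A B C : comAlgType k) (f : B -> C) (g : A -> B) :
  monoid_morphism f -> monoid_morphism g -> monoid_morphism (f \o g).
Proof.
by move=> [f1 fM] [g1 gM]; split=> [|x y] /=; rewrite ?g1 // gM fM.
Qed.

Lemma linear_id (U : lmodType k) : linear (@id U). Proof. by []. Qed.
Lemma monoid_id (A : comAlgType k) : monoid_morphism (@id A). Proof. by []. Qed.

Lemma lrmorph_linear (A B : comAlgType k) (f : {lrmorphism A -> B}) : linear f.
Proof. exact: linearP. Qed.
Lemma lrmorph_monoid (A B : comAlgType k) (f : {lrmorphism A -> B}) :
  monoid_morphism f.
Proof. by split; [exact: rmorph1|exact: rmorphM]. Qed.

End TensorAlgebraMaps.

HB.mixin Record Lmodule_isLeibniz (k : fieldType) h of GRing.Lmodule k h := {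
  brk : h -> h -> h;
  brk_bilin : bilin brk;
  brk_leibniz : forall x y z,
    brk x (brk y z) = brk (brk x y) z - brk (brk x z) y
}.

#[short(type="leibnizType")]
HB.structure Definition Leibniz (k : fieldType) :=
  {h of Lmodule_isLeibniz k h & GRing.Lmodule k h}.

#[short(type="finLeibnizType")]
HB.structure Definition FinLeibniz (k : fieldType) :=
  {h of Leibniz k h & Vector k h}.

Section CurrentLeibniz.
Variables (k : fieldType) (h : leibnizType k) (A : comAlgType k).

Definition tensor_brk (x y : h ⊗ A) : h ⊗ A := tmap2 brk *%R x y.

Lemma tensor_brk_bilin : bilin tensor_brk.
Proof. by apply: tmap2_bilin; [exact: brk_bilin|exact: mul_bilin]. Qed.

Lemma tensor_brk_tens x y a b :
  tensor_brk (x ⊗ a) (y ⊗ b) = brk x y ⊗ (a * b).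
Proof. by apply: tmap2_tens; [exact: brk_bilin|exact: mul_bilin]. Qed.

Lemma tensor_brk_leibniz x y z :
  tensor_brk x (tensor_brk y z) =
  tensor_brk (tensor_brk x y) z - tensor_brk (tensor_brk x z) y.
Proof.
have bb := tensor_brk_bilin.
elim/tensor_ind: x => [|p a x IHx].
  by rewrite !(bilin0l bb) subrr.
rewrite !(bilinDl bb) IHx opprD addrACA; congr (_ + _) => {x IHx}.
elim/tensor_ind: y => [|q b y IHy].
  by rewrite !((bilin0l bb), (bilin0r bb)) subrr.
rewrite !((bilinDl bb), (bilinDr bb)) IHy opprD addrACA.
congr (_ + _) => {y IHy}.
elim/tensor_ind: z => [|r c z IHz].
  by rewrite !((bilin0l bb), (bilin0r bb)) subrr.
rewrite !((bilinDl bb), (bilinDr bb)) IHz opprD addrACA; congr (_ + _).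
rewrite !tensor_brk_tens brk_leibniz -[a * c * b]mulrA [c * b]mulrC !mulrA.
by rewrite tensDl -[- brk _ _]scaleN1r tensZl scaleN1r.
Qed.

HB.instance Definition _ := Lmodule_isLeibniz.Build k (tensor h A)
  tensor_brk_bilin tensor_brk_leibniz.

End CurrentLeibniz.

Definition leibniz_hom (k : fieldType) (g h : leibnizType k) (f : g -> h) :=
  linear f /\ {morph f : x y / brk x y}.

HB.mixin Record ComAlgebra_isComBialgebra (k : fieldType) B
    of GRing.ComAlgebra k B := {
  comul : {lrmorphism B -> tensor B B};
  counit : {lrmorphism B -> k^o};
  comulA : forall b : B, tassoc (tmap comul id (comul b)) = tmap id comul (comul b);
  counitl : forall b : B, tmap counit id (comul b) = (1 : k^o) ⊗ b;
  counitr : forall b : B, tmap id counit (comul b) = b ⊗ (1 : k^o)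
}.

#[short(type="comBialgType")]
HB.structure Definition ComBialgebra (k : fieldType) :=
  {B of ComAlgebra_isComBialgebra k B & GRing.ComAlgebra k B}.

Definition bialg_hom (k : fieldType) (A B : comBialgType k) (f : A -> B) : Prop :=
  [/\ linear f, monoid_morphism f,
      forall a, comul (f a) = tmap f f (comul a)
    & forall a, counit (f a) = counit a].

Definition right_comodule (k : fieldType) (B : comBialgType k)
    (V : lmodType k) (rho : V -> V ⊗ B) : Prop :=
  [/\ linear rho,
      forall v, tassoc (tmap rho id (rho v)) = tmap id comul (rho v)
    & forall v, tmap id counit (rho v) = v ⊗ (1 : k^o)].

(* tau i j s plays the role of the coefficient of e_s in [e_i, e_j].  The
   bialgebra structure below needs no hypothesis on tau. *)
Section CoactDef.
Variables (k : fieldType) (n : nat) (tau : 'I_n -> 'I_n -> 'I_n -> k).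

(* The n * n indeterminates are numbered by mxvec_index. *)
Definition coact_var (i j : 'I_n) : {mpoly k[n * n]} := 'X_(mxvec_index i j).

Definition coact_rel (a i j : 'I_n) : {mpoly k[n * n]} :=
  \sum_u tau i j u *: coact_var a u -
  \sum_s \sum_t tau s t a *: (coact_var s i * coact_var t j).

Definition coact_ideal (p : {mpoly k[n * n]}) : bool :=
  `[< exists c : 'I_n -> 'I_n -> 'I_n -> {mpoly k[n * n]},
        p = \sum_a \sum_i \sum_j c a i j * coact_rel a i j >].

Definition coact_sat (S : comAlgType k) (g : 'M[S]_n) : Prop :=
  forall a i j, \sum_u tau i j u *: g a u =
                \sum_s \sum_t tau s t a *: (g s i * g t j).

Section Eval.
Variables (S : comAlgType k) (g : 'M[S]_n).

Definition coact_eval (p : {mpoly k[n * n]}) : S := mmap (in_alg S) (mxvec g 0) p.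

HB.instance Definition _ := GRing.RMorphism.copy coact_eval
  (mmap (in_alg S) (mxvec g 0)).

Lemma coact_evalZ : scalable coact_eval.
Proof. by move=> a p; rewrite /coact_eval mmapZ /= mulr_algl. Qed.

HB.instance Definition _ := GRing.isScalable.Build k _ _ _ coact_eval coact_evalZ.

Lemma coact_eval_var i j : coact_eval (coact_var i j) = g i j.
Proof. by rewrite /coact_eval mmapX mmap1U mxvecE. Qed.

Lemma coact_eval_ideal p : coact_sat g -> coact_ideal p -> coact_eval p = 0.
Proof.
move=> gs /asboolP[c ->]; rewrite raddf_sum /= big1 // => a _.
rewrite raddf_sum /= big1 // => i _; rewrite raddf_sum /= big1 // => j _.
rewrite rmorphM /= [X in _ * X](_ : _ = 0) ?mulr0 //.
rewrite /coact_rel rmorphB !rmorph_sum /=; apply/eqP; rewrite subr_eq0; apply/eqP.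
transitivity (\sum_u tau i j u *: g a u).
  by apply: eq_bigr => u _; rewrite coact_evalZ /= coact_eval_var.
rewrite gs; apply: eq_bigr => s _; rewrite rmorph_sum /=; apply: eq_bigr => t _.
by rewrite coact_evalZ /= rmorphM /= !coact_eval_var.
Qed.

End Eval.

Lemma coact_sat1 : @coact_sat k^o 1%:M.
Proof.
move=> a i j; rewrite (bigD1 a) //= big1 => [|u /negPf ua]; last first.
  by rewrite mxE eq_sym ua scaler0.
rewrite (bigD1 i) //= [X in _ = _ + X]big1 => [|s /negPf si]; last first.
  by rewrite big1 // => t _; rewrite mxE si mul0r scaler0.
rewrite (bigD1 j) //= [X in _ = _ + X + _]big1 => [|t /negPf tj]; last first.
  by rewrite [X in _ * X]mxE tj mulr0 scaler0.
by rewrite !mxE !eqxx !addr0 mulr1.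
Qed.

Lemma coact_ideal_closed : idealr_closed coact_ideal.
Proof.
split=> [||a p q /asboolP[c ->] /asboolP[d ->]].
- apply/asboolP; exists (fun _ _ _ => 0).
  by rewrite big1 // => a _; rewrite big1 // => i _; rewrite big1 // => j _;
    rewrite mul0r.
- apply/negP => /(coact_eval_ideal coact_sat1) /eqP.
  by rewrite rmorph1 oner_eq0.
apply/asboolP; exists (fun x i j => a * c x i j + d x i j).
rewrite mulr_sumr -big_split; apply: eq_bigr => x _.
rewrite mulr_sumr -big_split; apply: eq_bigr => i _.
rewrite mulr_sumr -big_split; apply: eq_bigr => j _.
by rewrite mulrDl mulrA.
Qed.

HB.instance Definition _ := isIdealr.Build _ coact_ideal coact_ideal_closed.

Definition coact_alg :=
  {ideal_quot (coact_ideal : idealr {mpoly k[n * n]})}.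

HB.instance Definition _ := GRing.ComNzRing.on coact_alg.

Definition coact_pi (p : {mpoly k[n * n]}) : coact_alg := \pi_coact_alg p.

Definition coact_gen (i j : 'I_n) : coact_alg := coact_pi (coact_var i j).

Lemma coact_pi_repr x : coact_pi (repr x) = x. Proof. exact: reprK. Qed.

Lemma coact_piP p q : coact_pi p = coact_pi q <-> coact_ideal (p - q).
Proof.
split=> [/eqP|h]; first by rewrite -[_ == _]Quotient.idealrBE.
by apply/eqP; rewrite -[_ == _]Quotient.idealrBE.
Qed.

Lemma coact_pi_zmod : zmod_morphism coact_pi.
Proof. by move=> p q; rewrite /coact_pi raddfB. Qed.

Lemma coact_pi_monoid : monoid_morphism coact_pi.
Proof. by split=> [|p q]; rewrite /coact_pi ?rmorph1 ?rmorphM. Qed.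

HB.instance Definition _ :=
  GRing.isZmodMorphism.Build _ _ coact_pi coact_pi_zmod.
HB.instance Definition _ :=
  GRing.isMonoidMorphism.Build _ _ coact_pi coact_pi_monoid.

Definition coact_scale (a : k) (x : coact_alg) : coact_alg :=
  coact_pi a%:MP * x.

Lemma coact_scaleA a b x :
  coact_scale a (coact_scale b x) = coact_scale (a * b) x.
Proof. by rewrite /coact_scale mulrA -rmorphM /= mpolyCM. Qed.

Lemma coact_scale1 : left_id 1 coact_scale.
Proof. by move=> x; rewrite /coact_scale mpolyC1 rmorph1 mul1r. Qed.

Lemma coact_scaleDr : right_distributive coact_scale +%R.
Proof. by move=> a x y; rewrite /coact_scale mulrDr. Qed.

Lemma coact_scaleDl x : {morph coact_scale^~ x : a b / a + b}.
Proof. by move=> a b; rewrite /coact_scale mpolyCD rmorphD mulrDl. Qed.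

HB.instance Definition _ := GRing.Zmodule_isLmodule.Build k coact_alg
  coact_scaleA coact_scale1 coact_scaleDr coact_scaleDl.

Lemma coact_scaleAl a (x y : coact_alg) : a *: (x * y) = (a *: x) * y.
Proof. exact: mulrA. Qed.

HB.instance Definition _ :=
  GRing.Lmodule_isLalgebra.Build k coact_alg coact_scaleAl.
HB.instance Definition _ := GRing.Lalgebra_isComAlgebra.Build k coact_alg.

Lemma coact_piZ : scalable coact_pi.
Proof. by move=> a p; rewrite -mul_mpolyC rmorphM. Qed.

HB.instance Definition _ := GRing.isScalable.Build k _ _ _ coact_pi coact_piZ.

Section Lift.
Variables (S : comAlgType k) (g : 'M[S]_n) (gs : coact_sat g).

Definition coact_lift of coact_sat g : coact_alg -> S :=
  fun x => coact_eval g (repr x).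

Lemma coact_lift_pi p : coact_lift gs (coact_pi p) = coact_eval g p.
Proof.
apply/eqP; rewrite -subr_eq0 /coact_lift -raddfB; apply/eqP.
by apply: coact_eval_ideal => //; apply/coact_piP; rewrite coact_pi_repr.
Qed.

Lemma coact_lift_zmod : zmod_morphism (coact_lift gs).
Proof.
move=> x y; rewrite -[x]coact_pi_repr -[y]coact_pi_repr -raddfB.
by rewrite !coact_lift_pi raddfB.
Qed.

Lemma coact_lift_monoid : monoid_morphism (coact_lift gs).
Proof.
split=> [|x y]; first by rewrite -(rmorph1 coact_pi) coact_lift_pi rmorph1.
rewrite -[x]coact_pi_repr -[y]coact_pi_repr -rmorphM.
by rewrite !coact_lift_pi rmorphM.
Qed.

Lemma coact_liftZ : scalable (coact_lift gs).
Proof.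
by move=> a x; rewrite -[x]coact_pi_repr -linearZ !coact_lift_pi linearZ.
Qed.

HB.instance Definition _ :=
  GRing.isZmodMorphism.Build _ _ (coact_lift gs) coact_lift_zmod.
HB.instance Definition _ :=
  GRing.isMonoidMorphism.Build _ _ (coact_lift gs) coact_lift_monoid.
HB.instance Definition _ :=
  GRing.isScalable.Build k _ _ _ (coact_lift gs) coact_liftZ.

Lemma coact_lift_gen i j : coact_lift gs (coact_gen i j) = g i j.
Proof. by rewrite coact_lift_pi coact_eval_var. Qed.

End Lift.

Lemma coact_alg_ext (S : comAlgType k) (f g : coact_alg -> S) :
  linear f -> monoid_morphism f -> linear g -> monoid_morphism g ->
  (forall i j, f (coact_gen i j) = g (coact_gen i j)) -> f =1 g.
Proof.
move=> fl [f1 fM] gl [g1 gM] fg x; rewrite -[x]coact_pi_repr.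
elim/mpolyind: (repr x) => [|c m p _ _ IHp]; first by rewrite raddf0 !lin0.
rewrite raddfD /= coact_piZ fl gl IHp; congr (_ *: _ + _).
rewrite mpolyXE_id rmorph_prod; set r := index_enum _.
elim: r => [|i r IHr]; first by rewrite big_nil f1 g1.
rewrite big_cons fM gM IHr; congr (_ * _); rewrite rmorphXn.
elim: (m i) => [|d IHd]; first by rewrite !expr0 f1 g1.
rewrite !exprS fM gM IHd; congr (_ * _) => {d IHd}.
by case/mxvec_indexP: i => i j; exact: fg.
Qed.

Lemma coact_gen_sat : coact_sat (\matrix_(i, j) coact_gen i j).
Proof.
move=> a i j; apply/eqP; rewrite -subr_eq0.
have /(coact_piP _ 0) : coact_ideal (coact_rel a i j - 0).
  rewrite subr0; apply/asboolP.
  exists (fun a' i' j' => ((a' == a) && (i' == i) && (j' == j))%:R).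
  rewrite (bigD1 a) //= [X in _ + X]big1 => [|a' /negPf->]; last first.
    by rewrite big1 // => i' _; rewrite big1 // => j' _; rewrite mul0r.
  rewrite (bigD1 i) //= [X in _ + X + _]big1 => [|i' /negPf->]; last first.
    by rewrite big1 // => j' _; rewrite andbF mul0r.
  rewrite (bigD1 j) //= big1 => [|j' /negPf->]; last by rewrite andbF mul0r.
  by rewrite !eqxx mul1r !addr0.
rewrite [RHS]raddf0 => e; apply/eqP; apply: etrans e.
rewrite /coact_rel rmorphB !rmorph_sum /=.
congr (_ - _); apply: eq_bigr => s _; first by rewrite coact_piZ mxE.
rewrite rmorph_sum /=; apply: eq_bigr => t _.
by rewrite coact_piZ rmorphM !mxE.
Qed.

Definition coact_comul_mx : 'M[coact_alg ⊗ coact_alg]_n :=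
  \matrix_(i, j) \sum_s (coact_gen i s ⊗ coact_gen s j).

Lemma coact_comul_sat : coact_sat coact_comul_mx.
Proof.
have gs a i j : \sum_u tau i j u *: coact_gen a u =
    \sum_s \sum_t tau s t a *: (coact_gen s i * coact_gen t j).
  have := coact_gen_sat a i j.
  under eq_bigr do rewrite mxE; move=> ->.
  by apply: eq_bigr => s _; apply: eq_bigr => t _; rewrite !mxE.
move=> a i j.
transitivity (\sum_b \sum_s \sum_t
    (tau s t b *: coact_gen a b) ⊗ (coact_gen s i * coact_gen t j)).
  transitivity (\sum_b (coact_gen a b ⊗ \sum_u tau i j u *: coact_gen b u)).
    under eq_bigr do rewrite mxE scaler_sumr.
    rewrite exchange_big; apply: eq_bigr => b _; rewrite tens_sumr.
    by apply: eq_bigr => u _; rewrite tensZr.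
  apply: eq_bigr => b _; rewrite gs tens_sumr; apply: eq_bigr => s _.
  rewrite tens_sumr; apply: eq_bigr => t _.
  by rewrite tensZl tensZr.
rewrite exchange_big /=.
transitivity (\sum_s \sum_t \sum_p \sum_q (tau p q a *:
    ((coact_gen p s * coact_gen q t) ⊗ (coact_gen s i * coact_gen t j)))).
  apply: eq_bigr => s _; rewrite exchange_big; apply: eq_bigr => t _.
  rewrite -tens_suml gs tens_suml; apply: eq_bigr => p _.
  by rewrite tens_suml; apply: eq_bigr => q _; rewrite tensZl.
transitivity (\sum_s \sum_p \sum_t \sum_q (tau p q a *:
    ((coact_gen p s * coact_gen q t) ⊗ (coact_gen s i * coact_gen t j)))).
  by apply: eq_bigr => s _; rewrite exchange_big.
rewrite exchange_big /=; apply: eq_bigr => p _.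
transitivity (\sum_s \sum_q \sum_t (tau p q a *:
    ((coact_gen p s * coact_gen q t) ⊗ (coact_gen s i * coact_gen t j)))).
  by apply: eq_bigr => s _; rewrite exchange_big.
rewrite exchange_big /=; apply: eq_bigr => q _.
rewrite !mxE mulr_suml scaler_sumr; apply: eq_bigr => s _.
rewrite mulr_sumr scaler_sumr; apply: eq_bigr => t _.
by rewrite tens_mul.
Qed.

Definition coact_comul : {lrmorphism coact_alg -> coact_alg ⊗ coact_alg} :=
  coact_lift coact_comul_sat.

Definition coact_counit : {lrmorphism coact_alg -> k^o} :=
  coact_lift coact_sat1.

Lemma coact_comul_gen i j :
  coact_comul (coact_gen i j) = \sum_s (coact_gen i s ⊗ coact_gen s j).
Proof. by rewrite /coact_comul /= coact_lift_gen mxE. Qed.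

Lemma coact_counit_gen i j : coact_counit (coact_gen i j) = (i == j)%:R.
Proof. by rewrite /coact_counit /= coact_lift_gen mxE. Qed.

Local Notation cl := (lrmorph_linear coact_comul).
Local Notation cm := (lrmorph_monoid coact_comul).
Local Notation el := (lrmorph_linear coact_counit).
Local Notation em := (lrmorph_monoid coact_counit).
Local Notation il := (@linear_id k coact_alg).
Local Notation im := (@monoid_id k coact_alg).

Let tmap_sum (U V U' V' : lmodType k) (f : U -> U') (g : V -> V')
    (u : 'I_n -> U) (v : 'I_n -> V) : linear f -> linear g ->
  tmap f g (\sum_s (u s ⊗ v s)) = \sum_s (f (u s) ⊗ g (v s)).
Proof.
move=> fl gl; have tl := tmap_linear fl gl.
rewrite (big_morph (tmap f g) (id1 := 0) (op1 := +%R)).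
- by apply: eq_bigr => s _; rewrite tmap_tens.
- by move=> x y; have := tl 1 x y; rewrite !scale1r.
- exact: lin0 tl.
Qed.

Lemma coact_comulA x :
  tassoc (tmap coact_comul id (coact_comul x)) =
  tmap id coact_comul (coact_comul x).
Proof.
apply: (@coact_alg_ext _ (@tassoc k _ _ _ \o tmap coact_comul id \o coact_comul)
  (tmap id coact_comul \o coact_comul)) => [||||i j] /=.
- apply: linear_comp cl; apply: linear_comp (@tassoc_linear _ _ _ _) _.
  exact: tmap_linear cl il.
- apply: monoid_comp cm; apply: monoid_comp (@tassoc_monoid _ _ _ _) _.
  exact: tmap_monoid cl cm il im.
- exact: linear_comp (tmap_linear il cl) cl.
- exact: monoid_comp (tmap_monoid il im cl cm) cm.
rewrite coact_comul_gen (tmap_sum _ _ cl il) (tmap_sum _ _ il cl).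
under eq_bigr do rewrite coact_comul_gen tens_suml.
have tl := @tassoc_linear k coact_alg coact_alg coact_alg.
have tD u v : tassoc (u + v) =
    tassoc u + tassoc v :> coact_alg ⊗ (coact_alg ⊗ coact_alg).
  by have := tl 1 u v; rewrite !scale1r.
rewrite (big_morph _ tD (lin0 tl)).
under eq_bigr do rewrite (big_morph _ tD (lin0 tl)).
rewrite exchange_big /=; apply: eq_bigr => s _.
rewrite coact_comul_gen tens_sumr; apply: eq_bigr => t _.
by rewrite tassoc_tens.
Qed.

Lemma coact_counitl x : tmap coact_counit id (coact_comul x) = (1 : k^o) ⊗ x.
Proof.
apply: (@coact_alg_ext _ (tmap coact_counit id \o coact_comul)
  (fun x => (1 : k^o) ⊗ x)) => [||||i j] /=.
- exact: linear_comp (tmap_linear el il) cl.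
- exact: monoid_comp (tmap_monoid el em il im) cm.
- by move=> a y z; rewrite tensDr tensZr.
- by split=> [|y z]; rewrite ?tens_one // tens_mul mulr1.
rewrite coact_comul_gen (tmap_sum _ _ el il) (bigD1 i) //= big1 => [|s /negPf si].
  by rewrite coact_counit_gen eqxx addr0.
by rewrite coact_counit_gen eq_sym si tens0l.
Qed.

Lemma coact_counitr x : tmap id coact_counit (coact_comul x) = x ⊗ (1 : k^o).
Proof.
apply: (@coact_alg_ext _ (tmap id coact_counit \o coact_comul)
  (fun x => x ⊗ (1 : k^o))) => [||||i j] /=.
- exact: linear_comp (tmap_linear il el) cl.
- exact: monoid_comp (tmap_monoid il im el em) cm.
- by move=> a y z; rewrite tensDl tensZl.
- by split=> [|y z]; rewrite ?tens_one // tens_mul mulr1.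
rewrite coact_comul_gen (tmap_sum _ _ il el) (bigD1 j) //= big1 => [|s /negPf sj].
  by rewrite coact_counit_gen eqxx addr0.
by rewrite coact_counit_gen sj tens0r.
Qed.

HB.instance Definition _ := ComAlgebra_isComBialgebra.Build k coact_alg
  coact_comulA coact_counitl coact_counitr.

End CoactDef.

Section UniversalCoacting.
Variables (k : fieldType) (n : nat) (h : finLeibnizType k) (e : n.-tuple h).

(* coord is meaningful only when e is free; e is a basis in all uses. *)
Definition structure_const (i j s : 'I_n) : k := coord e s (brk e`_i e`_j).

Definition univ_coact := coact_alg structure_const.

HB.instance Definition _ := ComBialgebra.on univ_coact.

Definition univ_gen (i j : 'I_n) : univ_coact := coact_gen structure_const i j.

(* The linear map with e_i |-> sum_s e_s (x) x_si, for e a basis of h. *)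
Definition univ_coaction (x : h) : h ⊗ univ_coact :=
  \sum_(i < n) coord e i x *: \sum_(s < n) (e`_s ⊗ univ_gen s i).

Lemma univ_coaction_linear : linear univ_coaction.
Proof.
move=> a x y; rewrite /univ_coaction scaler_sumr -big_split.
by apply: eq_bigr => i _ /=; rewrite linearP scalerDl scalerA.
Qed.

Lemma sumD_lin (U V : lmodType k) (f : U -> V) I (r : seq I) (F : I -> U) :
  linear f -> f (\sum_(i <- r) F i) = \sum_(i <- r) f (F i).
Proof.
move=> fl; apply: (big_morph f _ (lin0 fl)) => x y.
by have := fl 1 x y; rewrite !scale1r.
Qed.

Lemma linZ (U V : lmodType k) (f : U -> V) a x :
  linear f -> f (a *: x) = a *: f x.
Proof. by move=> fl; have := fl a x 0; rewrite (lin0 fl) !addr0. Qed.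

Lemma univ_gen_rel a i j :
  \sum_(u < n) structure_const i j u *: univ_gen a u =
  \sum_(s < n) \sum_(t < n)
    structure_const s t a *: (univ_gen s i * univ_gen t j).
Proof.
have := coact_gen_sat structure_const a i j.
under eq_bigr do rewrite mxE; move=> ->.
by apply: eq_bigr => s _; apply: eq_bigr => t _; rewrite !mxE.
Qed.

Hypothesis e_basis : basis_of fullv e.

Lemma univ_coaction_basis (i : 'I_n) :
  univ_coaction e`_i = \sum_(s < n) (e`_s ⊗ univ_gen s i).
Proof.
rewrite /univ_coaction (bigD1 i) //= [X in _ + X]big1 => [|j ji].
  by rewrite coord_free ?(basis_free e_basis) // eqxx scale1r addr0.
by rewrite coord_free ?(basis_free e_basis) // eq_sym (negPf ji) scale0r.
Qed.

Lemma eq_on_basis (U : lmodType k) (f g : h -> U) : linear f -> linear g ->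
  (forall i : 'I_n, f e`_i = g e`_i) -> f =1 g.
Proof.
move=> fl gl fg x; rewrite (coord_basis e_basis (memvf x)) !sumD_lin //.
by apply: eq_bigr => i _; rewrite !linZ // fg.
Qed.

Lemma univ_coaction_leibniz : leibniz_hom univ_coaction.
Proof.
have ul := univ_coaction_linear.
have bb : bilin (@brk k h) := brk_bilin.
have tb : bilin (@brk k (tensor h univ_coact)) := brk_bilin.
split=> [//|x y].
apply: (@eq_on_basis _ (fun x => univ_coaction (brk x y))
  (fun x => brk (univ_coaction x) (univ_coaction y))) => [||i].
- by apply: linear_comp ul _; exact: bb.1.
- apply: (linear_comp (f := fun z => brk z (univ_coaction y))) => //.
  exact: tb.1.
apply: (@eq_on_basis _ (fun y => univ_coaction (brk e`_i y))
  (fun y => brk (univ_coaction e`_i) (univ_coaction y))) => [||j].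
- by apply: linear_comp ul _; exact: bb.2.
- apply: (linear_comp (f := brk (univ_coaction e`_i))) => //.
  exact: tb.2.
have brkE (p q : 'I_n) : brk e`_p e`_q = \sum_(u < n) structure_const p q u *: e`_u.
  exact: coord_basis e_basis (memvf _).
rewrite brkE (sumD_lin _ _ ul) !univ_coaction_basis.
transitivity (\sum_(a < n) (e`_a ⊗
    \sum_(u < n) structure_const i j u *: univ_gen a u)).
  under [RHS]eq_bigr do rewrite tens_sumr.
  rewrite [RHS]exchange_big; apply: eq_bigr => u _.
  rewrite (linZ _ _ ul) univ_coaction_basis scaler_sumr.
  by apply: eq_bigr => a _; rewrite tensZr.
rewrite (sumD_lin _ _ (tb.1 _)).
transitivity (\sum_(s < n) \sum_(t < n) \sum_(a < n)
    structure_const s t a *: (e`_a ⊗ (univ_gen s i * univ_gen t j))).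
  under eq_bigr do rewrite univ_gen_rel tens_sumr.
  rewrite exchange_big; apply: eq_bigr => s _ /=.
  under eq_bigr do rewrite tens_sumr.
  rewrite exchange_big; apply: eq_bigr => t _ /=.
  by apply: eq_bigr => a _; rewrite tensZr.
apply: eq_bigr => s _; rewrite (sumD_lin _ _ (tb.2 _)).
apply: eq_bigr => t _; rewrite [RHS]tensor_brk_tens brkE tens_suml.
by apply: eq_bigr => a _; rewrite tensZl.
Qed.

Lemma univ_coaction_comodule : right_comodule univ_coaction.
Proof.
have ul := univ_coaction_linear.
have il := @linear_id k univ_coact; have ih := @linear_id k h.
have cl : linear (@comul k univ_coact) := lrmorph_linear _.
have el : linear (@counit k univ_coact) := lrmorph_linear _.
have al := @tassoc_linear k h univ_coact univ_coact.
split=> // x.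
  apply: (@eq_on_basis _ (@tassoc k _ _ _ \o tmap univ_coaction id \o univ_coaction)
    (tmap id comul \o univ_coaction)) => [||i] /=.
  - exact: linear_comp (linear_comp al (tmap_linear ul il)) ul.
  - exact: linear_comp (tmap_linear ih cl) ul.
  rewrite univ_coaction_basis !(sumD_lin _ _ (tmap_linear _ _)) //.
  rewrite (sumD_lin _ _ al).
  transitivity (\sum_(s < n) \sum_(a < n) tassoc ((e`_a ⊗ univ_gen a s) ⊗ univ_gen s i)).
    apply: eq_bigr => s _; rewrite tmap_tens // univ_coaction_basis tens_suml.
    by rewrite (sumD_lin _ _ al).
  rewrite exchange_big; apply: eq_bigr => a _ /=.
  rewrite tmap_tens // [comul _]coact_comul_gen tens_sumr.
  by apply: eq_bigr => s _; rewrite tassoc_tens.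
apply: (@eq_on_basis _ (tmap id counit \o univ_coaction)
  (fun x => x ⊗ (1 : k^o))) => [||i] /=.
- exact: linear_comp (tmap_linear ih el) ul.
- by move=> a y z; rewrite tensDl tensZl.
rewrite univ_coaction_basis (sumD_lin _ _ (tmap_linear ih el)).
rewrite (bigD1 i) //= big1 => [|s si]; rewrite tmap_tens //.
  by rewrite [counit _]coact_counit_gen eqxx addr0.
by rewrite [counit _]coact_counit_gen (negPf si) tens0r.
Qed.

End UniversalCoacting.

(* Main.v *)
Require Import Defs.
From HB Require Import structures.
From mathcomp Require Import all_boot all_algebra.
From mathcomp Require Import boolp.

Set Implicit Arguments.
Unset Strict Implicit.
Unset Printing Implicit Defensive.

Import GRing.Theory.
Local Open Scope ring_scope.

(** With respect to the basis [e], a linear map [f : h -> h ⊗ B] is a matrix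
    [g] over [B], [f e_i = \sum_s e_s ⊗ g s i]. Comparing coefficients of the
    [e_a], [f] is a Leibniz homomorphism exactly when [g] satisfies the relations
    defining A(h), and a comodule structure exactly when
    [Δ (g i j) = \sum_s g i s ⊗ g s j] and [ε (g i j) = δ_ij]. So [x_ij |-> g i j]
    defines a bialgebra map, and it is the only possible one. *)

Section TensorCoord.
Variables (k : fieldType) (n : nat) (U : vectType k) (e : n.-tuple U).
Variable W : lmodType k.

(** The linear form [coord e i] tensored with the identity of [W], followed by the identification of
    k ⊗ W with [W]. *)
Definition tcoord (i : 'I_n) : U ⊗ W -> W := tlift (fun u w => coord e i u *: w).

Lemma tcoord_bilin i : bilin (fun (u : U) (w : W) => coord e i u *: w).
Proof.
split=> [w a u u'|u a w w'] /=; first by rewrite linearP scalerDl scalerA.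
by rewrite scalerDr !scalerA mulrC.
Qed.

Lemma tcoord_linear i : linear (tcoord i).
Proof. exact/tlift_linear/tcoord_bilin. Qed.

Lemma tcoord_tens i u w : tcoord i (u ⊗ w) = coord e i u *: w.
Proof. exact/tlift_tens/tcoord_bilin. Qed.

Hypothesis e_basis : basis_of fullv e.

Lemma tcoord_sum i (w : 'I_n -> W) : tcoord i (\sum_(s < n) (e`_s ⊗ w s)) = w i.
Proof.
rewrite (sumD_lin _ _ (tcoord_linear i)) (bigD1 i) //= big1 => [|s si].
  by rewrite tcoord_tens coord_free ?(basis_free e_basis) // eqxx scale1r addr0.
rewrite tcoord_tens coord_free ?(basis_free e_basis) //.
by rewrite (negPf si) scale0r.
Qed.

(** By additivity a pure tensor [u ⊗ w] suffices; there [u] is expanded in the basis and its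
    coordinates are moved across the tensor sign. *)
Lemma sum_tcoord t : t = \sum_(i < n) (e`_i ⊗ tcoord i t).
Proof.
elim/tensor_ind: t => [|u w t {1}->].
  by rewrite big1 // => i _; rewrite (lin0 (tcoord_linear i)) tens0r.
rewrite {1}(coord_basis e_basis (memvf u)) tens_suml -big_split.
apply: eq_bigr => i _ /=; rewrite -[u ⊗ w]scale1r tcoord_linear scale1r.
by rewrite tcoord_tens tensDr tensZr tensZl.
Qed.

(** This is the comparison of coefficients: [tcoord i] recovers the factor next to the [i]-th basis
    vector. *)
Lemma tens_basis_inj (v w : 'I_n -> W) :
  \sum_(s < n) (e`_s ⊗ v s) = \sum_(s < n) (e`_s ⊗ w s) -> v =1 w.
Proof. by move=> vw i; rewrite -(tcoord_sum i v) vw tcoord_sum. Qed.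

End TensorCoord.

Section CoactionMatrix.
Variables (k : fieldType) (n : nat) (h : finLeibnizType k) (e : n.-tuple h).
Hypothesis e_basis : basis_of fullv e.
Variables (B : comBialgType k) (f : h -> h ⊗ B).

Definition coaction_mx : 'M[B]_n := \matrix_(s, i) tcoord e s (f e`_i).

Lemma coaction_mxE (i : 'I_n) : f e`_i = \sum_(s < n) (e`_s ⊗ coaction_mx s i).
Proof.
rewrite [LHS](sum_tcoord e_basis); apply: eq_bigr => s _.
by rewrite mxE.
Qed.

(** Both sides are the coefficient of e_a in f [e_i, e_j]: the left one after expanding the bracket
    in the basis, the right one after writing it as [f e_i, f e_j]. *)
Lemma coaction_mx_sat :
  leibniz_hom f -> coact_sat (structure_const e) coaction_mx.
Proof.
(* The index [a] is generalized again so that the relations for all [a] form one equality of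
   families, as [tens_basis_inj] expects. *)
move=> [fl fM] a i j; move: a.
have tb : bilin (@brk k (tensor h B)) := brk_bilin.
have brkE (p q : 'I_n) :
    brk e`_p e`_q = \sum_(u < n) structure_const e p q u *: e`_u.
  exact: coord_basis e_basis (memvf _).
apply: (tens_basis_inj e_basis (W := B)).
transitivity (f (brk e`_i e`_j)).
  rewrite brkE (sumD_lin _ _ fl).
  under eq_bigr do rewrite tens_sumr.
  rewrite exchange_big; apply: eq_bigr => u _ /=.
  rewrite (linZ _ _ fl) coaction_mxE scaler_sumr.
  by apply: eq_bigr => a _; rewrite tensZr.
rewrite fM !coaction_mxE (sumD_lin _ _ (tb.1 _)).
under [RHS]eq_bigr do rewrite tens_sumr.
rewrite [RHS]exchange_big; apply: eq_bigr => s _ /=.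
rewrite (sumD_lin _ _ (tb.2 _)).
under [RHS]eq_bigr do rewrite tens_sumr.
rewrite [RHS]exchange_big; apply: eq_bigr => t _ /=.
rewrite [LHS]tensor_brk_tens brkE tens_suml.
by apply: eq_bigr => a _; rewrite tensZl tensZr.
Qed.

(** Coassociativity of [f] at e_j is an equality in h ⊗ (B ⊗ B); this is its coefficient at e_i. *)
Lemma coaction_mx_comul i j : right_comodule f ->
  comul (coaction_mx i j) = \sum_s (coaction_mx i s ⊗ coaction_mx s j).
Proof.
move=> [fl fA _]; move: i.
have il := @linear_id k B; have ih := @linear_id k h.
have cl : linear (@comul k B) := lrmorph_linear _.
have al := @tassoc_linear k h B B.
apply: (tens_basis_inj e_basis (W := tensor B B)).
transitivity (tmap id comul (f e`_j)).
  rewrite coaction_mxE (sumD_lin _ _ (tmap_linear ih cl)).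
  by apply: eq_bigr => a _; rewrite tmap_tens.
rewrite -fA coaction_mxE (sumD_lin _ _ (tmap_linear fl il)) (sumD_lin _ _ al).
under [RHS]eq_bigr do rewrite tens_sumr.
rewrite [RHS]exchange_big; apply: eq_bigr => s _ /=.
rewrite tmap_tens // coaction_mxE tens_suml (sumD_lin _ _ al).
by apply: eq_bigr => a _; rewrite tassoc_tens.
Qed.

(** The coefficient at e_i of the counit axiom for [f] at e_j. *)
Lemma coaction_mx_counit i j : right_comodule f ->
  counit (coaction_mx i j) = (i == j)%:R.
Proof.
move=> [_ _ f1]; move: i.
have ih := @linear_id k h.
have el : linear (@counit k B) := lrmorph_linear _.
apply: (tens_basis_inj e_basis (W := k^o)).
transitivity (tmap id counit (f e`_j)).
  rewrite coaction_mxE (sumD_lin _ _ (tmap_linear ih el)).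
  by apply: eq_bigr => a _; rewrite tmap_tens.
(* The tensor e_j ⊗ 1 is the sum with Kronecker delta coefficients, of which only the term [s = j]
   survives. *)
rewrite f1 (bigD1 j) //= big1 => [|s /negPf ->]; last by rewrite tens0r.
by rewrite eqxx addr0.
Qed.

Lemma tmap_univ_coaction_basis (theta : univ_coact e -> B) (i : 'I_n) :
  linear theta ->
  tmap id theta (univ_coaction e e`_i) = \sum_(s < n) (e`_s ⊗ theta (univ_gen e s i)).
Proof.
move=> tl; have ih := @linear_id k h.
rewrite (univ_coaction_basis e_basis) (sumD_lin _ _ (tmap_linear ih tl)).
by apply: eq_bigr => s _; rewrite tmap_tens.
Qed.

(** The factorization of [f] thus amounts to prescribing [theta] on the generators, which serves
    existence and uniqueness alike. *)
Lemma tmap_univ_coactionP (theta : univ_coact e -> B) : linear f -> linear theta ->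
  tmap id theta \o univ_coaction e = f <->
  forall i j, theta (univ_gen e i j) = coaction_mx i j.
Proof.
move=> fl tl; have ih := @linear_id k h; split=> [tf i j|tg].
  move: i; apply: (tens_basis_inj e_basis (W := B)).
  by rewrite -coaction_mxE -tmap_univ_coaction_basis // -[in RHS]tf.
apply/funext/(eq_on_basis e_basis) => // [|i].
  exact: linear_comp (tmap_linear ih tl) (univ_coaction_linear e).
rewrite /= tmap_univ_coaction_basis // coaction_mxE.
by apply: eq_bigr => s _; rewrite tg.
Qed.

End CoactionMatrix.

(* Both compatibilities are equalities of algebra maps out of A(h), so it
   suffices to check them on the generators. *)
Lemma univ_coact_bialg_hom (k : fieldType) (n : nat) (h : finLeibnizType k)
    (e : n.-tuple h) (B : comBialgType k) (theta : univ_coact e -> B) :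
  linear theta -> monoid_morphism theta ->
  (forall i j, comul (theta (univ_gen e i j)) =
     \sum_s (theta (univ_gen e i s) ⊗ theta (univ_gen e s j))) ->
  (forall i j, counit (theta (univ_gen e i j)) = (i == j)%:R) ->
  bialg_hom theta.
Proof.
move=> tl tm tC tE.
have cl (C : comBialgType k) : linear (@comul k C) := lrmorph_linear _.
have cm (C : comBialgType k) : monoid_morphism (@comul k C) := lrmorph_monoid _.
have el (C : comBialgType k) : linear (@counit k C) := lrmorph_linear _.
have em (C : comBialgType k) : monoid_morphism (@counit k C) := lrmorph_monoid _.
split=> //.
  apply: (@coact_alg_ext _ _ _ _ (comul \o theta) (tmap theta theta \o comul)).
  - exact: linear_comp (cl B) tl.
  - exact: monoid_comp (cm B) tm.
  - exact: linear_comp (tmap_linear tl tl) (cl _).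
  - exact: monoid_comp (tmap_monoid tl tm tl tm) (cm _).
  move=> i j; rewrite /= [LHS]tC [X in tmap _ _ X]coact_comul_gen.
  rewrite (sumD_lin _ _ (tmap_linear tl tl)).
  by apply: eq_bigr => s _; rewrite tmap_tens.
apply: (@coact_alg_ext _ _ _ _ (counit \o theta) counit) => //.
- exact: linear_comp (el B) tl.
- exact: monoid_comp (em B) tm.
- exact: el.
- exact: em.
by move=> i j; rewrite /= [LHS]tE [RHS]coact_counit_gen.
Qed.

Theorem theorem2p11 (k : fieldType) (n : nat) (h : finLeibnizType k)
    (e : n.-tuple h) (e_basis : basis_of fullv e)
    (B : comBialgType k) (f : h -> h ⊗ B)
    (f_leibniz : leibniz_hom f) (f_comodule : right_comodule f) :
  exists! theta : univ_coact e -> B,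
    bialg_hom theta /\ tmap id theta \o univ_coaction e = f.
Proof.
have fl := f_leibniz.1.
(* Evaluation of polynomials at the matrix of [f] descends to the quotient because that matrix
   satisfies the defining relations. *)
pose theta : {lrmorphism univ_coact e -> B} :=
  coact_lift (coaction_mx_sat e_basis f_leibniz).
have tl : linear theta := lrmorph_linear theta.
have tm : monoid_morphism theta := lrmorph_monoid theta.
have tg i j : theta (univ_gen e i j) = coaction_mx e f i j.
  exact: coact_lift_gen.
exists theta; split=> [|phi [[pl pm _ _] /(tmap_univ_coactionP e_basis fl pl) pg]].
  split; last exact/tmap_univ_coactionP.
  apply: univ_coact_bialg_hom => // i j.
    rewrite tg coaction_mx_comul //.
    by apply: eq_bigr => s _; rewrite !tg.
  by rewrite tg coaction_mx_counit.
(* Both algebra maps send the generators to the entries of [coaction_mx e f], hence coincide. *)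
by apply/funext/coact_alg_ext => // i j; rewrite [LHS]tg [RHS]pg.
Qed.
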